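(* Let $p$ be a prime and let $n$ be a positive integer with $n \geq 2$ and $\gcd(p,n)=1$ (equivalently, $n$ is not divisible by $p$). Consider the diophantine equation $$nxy = p(x+y)$$ in the two variables $x,y$ taking values in the set $\mathbb{Z}^+$ of positive integers. Then: (i) If $n=2$ and $p \geq 3$, the equation has exactly three distinct solutions $(x,y)$, namely $$(x,y)=(p,p),\quad (x,y)=\left(p\left(\frac{p+1}{2}\right),\ \frac{p+1}{2}\right),\quad (x,y)=\left(\frac{p+1}{2},\ p\left(\frac{p+1}{2}\right)\right).$$ (ii) If $n \geq 3$ and $n$ is a divisor of $p+1$, the equation has exactly two distinct solutions $(x,y)$, namely $$(x,y)=\left(p\left(\frac{p+1}{n}\right),\ \frac{p+1}{n}\right),\quad (x,y)=\left(\frac{p+1}{n},\ p\left(\frac{p+1}{n}\right)\right).$$ (iii) If $n$ is not a divisor of $p+1$, the equation has no solution.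
   Context: Solutions are ordered pairs $(x,y)$ of positive integers; $\mathbb{Z}^+$ denotes the set of positive integers. *)

(* Defs.v *)
From mathcomp Require Import all_boot.
Set Implicit Arguments.
Unset Strict Implicit.
Unset Printing Implicit Defensive.

Definition is_solution (n p x y : nat) : Prop :=
  [/\ 0 < x, 0 < y & n * x * y = p * (x + y)].

(* The [uniq] conjunct makes [size s] the exact number of solutions. *)
Definition solutions_exactly (n p : nat) (s : seq (nat * nat)) : Prop :=
  uniq s /\ forall x y : nat, is_solution n p x y <-> (x, y) \in s.

(* Main.v *)
Require Import Defs.
From mathcomp Require Import all_boot.
From mathcomp Require Import zify.

(** The prime [p] divides [n * x * y] and is coprime to [n], so by the symmetry
    of the equation one may assume [x = p * a].  Cancelling [p] leaves
    [n * a * y = p * a + y], so [a] divides [y]; writing [y = b * a] and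
    cancelling [a] leaves [n * a * b = p + b], so [b] divides the prime [p].
    If [b = 1] then [n * a = p + 1], and the solution is [(p * a, a)].
    If [b = p] then [n * a = 2], which forces [n = 2] and [a = 1], and the
    solution is [(p, p)].  Conversely these pairs and their mirror images are
    solutions.  This is the content of [is_solutionP], valid for every
    [n >= 2] prime to [p]; the three cases of the theorem are read off from it.
    In the last case [(p, p)] is excluded as well: it needs [n = 2], hence [p]
    odd, and then [n] does divide [p + 1]. *)

Lemma is_solution_sym n p x y : is_solution n p x y -> is_solution n p y x.
Proof. by case=> x0 y0 e; split=> //; rewrite mulnAC e addnC. Qed.

(** The descent: two successive cancellations turn the equation into the
    statement that the quotient [y / a] divides [p]. *)
Lemma solution_of_multiple p n a y : prime p -> 2 <= n ->
  is_solution n p (p * a) y ->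
  (n * a = p + 1 /\ y = a) \/ [/\ n = 2, a = 1 & y = p].
Proof.
move=> hp hn [x0 y0 e].
have p0 := prime_gt0 hp.
have a0 : 0 < a by move: x0; rewrite muln_gt0 => /andP[].
have {}e : n * a * y = p * a + y.
  by apply/eqP; rewrite -(eqn_pmul2l p0) -e; apply/eqP; lia.
have /dvdnP[b yE] : a %| y.
  by rewrite -(dvdn_addr y (dvdn_mull p (dvdnn a))) -e mulnAC dvdn_mull.
subst y.
have {}e : n * a * b = p + b.
  by apply/eqP; rewrite -(eqn_pmul2r a0) mulnDl -e mulnA.
have : b %| p by rewrite -(dvdn_addl p (dvdnn b)) -e dvdn_mull.
case: (primeP hp) => _ h /h /orP[] /eqP bE; subst b.
  by left; split; [rewrite -e muln1 | rewrite mul1n].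
have na : n * a = 2.
  by apply/eqP; rewrite -(eqn_pmul2r p0) e mul2n addnn.
have a1 : a = 1 by nia.
by right; rewrite a1 muln1 in na *; split=> //; rewrite muln1.
Qed.

Lemma is_solutionP p n x y : prime p -> 2 <= n -> coprime p n ->
  is_solution n p x y <->
  [/\ n = 2, x = p & y = p] \/
  (exists2 c, n * c = p + 1 & (x, y) = (p * c, c) \/ (x, y) = (c, p * c)).
Proof.
move=> hp hn cpn; have p0 := prime_gt0 hp; split; last first.
  case=> [[-> -> ->]|[c nc]]; first by split=> //; lia.
  have sol : is_solution n p (p * c) c.
    have c0 : 0 < c by case: c nc => //; lia.
    split; rewrite ?muln_gt0 ?p0 //.
    by rewrite mulnCA nc -mulnA mulnDl mul1n.
  by case=> -[-> ->] //; apply: is_solution_sym.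
move=> s; case: (s) => _ _ e.
have : p %| x * y by rewrite -(Gauss_dvdr _ cpn) mulnA e dvdn_mulr.
rewrite Euclid_dvdM // => /orP[] /dvdnP[a aE]; rewrite mulnC in aE; subst.
- have [[na ->]|[-> -> ->]] := solution_of_multiple _ _ _ _ hp hn s.
    by right; exists a => //; left.
  by left; rewrite muln1.
- have [[na ->]|[-> -> ->]] := solution_of_multiple _ _ _ _ hp hn (is_solution_sym _ _ _ _ s).
    by right; exists a => //; right.
  by left; rewrite muln1.
Qed.

Theorem theorem1 (p n : nat) (hp : prime p) (hn : 2 <= n) (hpn : gcdn p n = 1) :
  [/\ n = 2 -> 3 <= p ->
        solutions_exactly n p
          [:: (p, p);
              (p * ((p + 1) %/ 2), (p + 1) %/ 2);
              ((p + 1) %/ 2, p * ((p + 1) %/ 2))],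
      3 <= n -> n %| p + 1 ->
        solutions_exactly n p
          [:: (p * ((p + 1) %/ n), (p + 1) %/ n);
              ((p + 1) %/ n, p * ((p + 1) %/ n))]
    & ~~ (n %| p + 1) ->
        ~ (exists x y : nat, is_solution n p x y)].
Proof.
have cpn : coprime p n by apply/eqP.
have n0 : 0 < n by apply: ltnW.
have p1 := prime_gt1 hp.
have two_dvd : n = 2 -> n %| p + 1.
  by move=> n2; move: cpn; rewrite n2 coprimen2 dvdn2 addn1 /= negbK.
have quotE c : n * c = p + 1 -> (p + 1) %/ n = c by move=> <-; rewrite mulKn.
split.
- move=> n2 p3; have /dvdnP[c cE] := two_dvd n2; subst n.
  rewrite mulnC in cE; have nc := esym cE.
  rewrite (quotE _ nc); split=> [|x y].
    rewrite /= !inE !xpair_eqE; nia.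
  rewrite is_solutionP // !inE; split.
    case=> [[_ -> ->]|[d /quotE]]; first by rewrite eqxx.
    by rewrite cE mulKn // => <- [] ->; rewrite eqxx ?orbT.
  case/or3P=> /eqP e; first by left; case: e => -> ->.
    by right; exists c => //; left.
  by right; exists c => //; right.
- move=> n3 /dvdnP[c cE]; rewrite mulnC in cE; have nc := esym cE.
  rewrite (quotE _ nc); split=> [|x y].
    rewrite /= !inE !xpair_eqE; nia.
  rewrite is_solutionP // !inE; split.
    case=> [[n2 _ _]|[d /quotE]]; first by rewrite n2 in n3.
    by rewrite cE mulKn // => <- [] ->; rewrite eqxx ?orbT.
  by case/orP=> /eqP e; right; exists c => //; [left | right].
- move=> ndvd [x [y]]; rewrite is_solutionP //.
  case=> [[/two_dvd d _ _]|[c nc _]]; first by rewrite d in ndvd.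
  by rewrite -nc dvdn_mulr in ndvd.
Qed.
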